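(* For any integers $s\ge 1$ and $k\ge 1$, $$\hat r_s(P_n^k)=O(n).$$ That is, for all fixed integers $s\ge 1$ and $k\ge 1$ there is a constant $K=K(s,k)$ such that $\hat r_s(P_n^k)\le K n$ for all sufficiently large positive integers $n$.
   Context: All graphs are finite and simple. For graphs $G,H$ and a positive integer $s$, write $G\rightarrow (H)_s$ if every $s$-colouring of the edges of $G$ (every map from $E(G)$ to a set of $s$ colours) contains a monochromatic copy of $H$ as a (not necessarily induced) subgraph. The $s$-colour size-Ramsey number of $H$ is $\hat r_s(H)=\min\{|E(G)| : G\rightarrow (H)_s\}$. $P_n$ is the path on $n$ vertices. For a graph $H$ and a positive integer $k$, the $k$th power $H^k$ is the graph with vertex set $V(H)$ in which two distinct vertices are adjacent if and only if their distance in $H$ is at most $k$. *)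

(* Defs.v *)
From mathcomp Require Import all_boot.

Set Implicit Arguments.
Unset Strict Implicit.
Unset Printing Implicit Defensive.

Record sgraph := SGraph {
  vertex :> finType;
  adj : rel vertex;
  adj_sym : symmetric adj;
  adj_irrefl : irreflexive adj
}.

Definition edges (G : sgraph) : {set {set G}} :=
  [set [set p.1; p.2] | p : G * G & adj p.1 p.2].

Definition edge (G : sgraph) := {e : {set G} | e \in edges G}.

Lemma mem_edges (G : sgraph) (x y : G) : ([set x; y] \in edges G) = adj x y.
Proof.
apply/imsetP/idP => [[[a b] /= ab E]|xy]; last first.
  by exists (x, y); first by rewrite inE.
rewrite inE /= in ab.
move: ab; have /setP {}E := E; move: (E a) (E b) (E x) (E y).
rewrite !inE /= !eqxx !orbT => /orP[]/eqP Ea /orP[]/eqP Eb.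
- by rewrite Ea Eb adj_irrefl.
- by rewrite Ea Eb.
- by rewrite Ea Eb adj_sym.
- by rewrite Ea Eb adj_irrefl.
Qed.

Definition walk (G : sgraph) (m : nat) (x y : G) : bool :=
  [exists p : m.-tuple G, path (@adj G) x p && (last x p == y)].

(* [dist x y] is [None] when [x] and [y] lie in different components; lengths
   below [#|G|] suffice for the minimum, see [distP]. *)
Definition dist (G : sgraph) (x y : G) : option nat :=
  ohead [seq m <- iota 0 #|G| | walk m x y].

Lemma walkP (G : sgraph) m (x y : G) :
  reflect (exists p, [/\ size p = m, path (@adj G) x p & last x p = y])
          (walk m x y).
Proof.
apply: (iffP existsP) => [[p /andP[xp /eqP <-]]|[p [<- xp <-]]].
  by exists p; rewrite size_tuple.
by exists (in_tuple p); rewrite xp eqxx.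
Qed.

Lemma walk_sym (G : sgraph) m (x y : G) : walk m x y = walk m y x.
Proof.
suff W (u v : G) : walk m u v -> walk m v u by apply/idP/idP; apply: W.
case/walkP=> p [<- up <-]; apply/walkP.
exists (rev (belast u p)); split; first by rewrite size_rev size_belast.
  by rewrite rev_path (eq_path (e' := @adj G)) // => a b; rewrite adj_sym.
by case: p {up} => //= a p; rewrite rev_cons last_rcons.
Qed.

Lemma dist_sym (G : sgraph) (x y : G) : dist x y = dist y x.
Proof. by rewrite /dist; under eq_filter do rewrite walk_sym. Qed.

Lemma walk_short (G : sgraph) m (x y : G) :
  walk m x y -> exists2 d, d <= m & (d < #|G|) && walk d x y.
Proof.
case/walkP=> p [<- xp <-]; case: (shortenP xp) => p' xp' U S.
exists (size p'); first by apply: uniq_leq_size => //; case/andP: U.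
apply/andP; split; last by apply/walkP; exists p'.
by have := max_card (mem (x :: p')); rewrite (card_uniqP U).
Qed.

Lemma distP (G : sgraph) (x y : G) (d : nat) :
  dist x y = Some d <-> walk d x y /\ forall m, walk m x y -> d <= m.
Proof.
have S : sorted ltn [seq m <- iota 0 #|G| | walk m x y].
  by apply: sorted_filter (iota_ltn_sorted _ _); apply: ltn_trans.
have M m : m \in [seq m <- iota 0 #|G| | walk m x y] = walk m x y && (m < #|G|).
  by rewrite mem_filter mem_iota add0n.
have min e : dist x y = Some e -> walk e x y /\ forall m, walk m x y -> e <= m.
  rewrite /dist; case: [seq _ <- _ | _] S M => //= a l al M [<-].
  have := M a; rewrite mem_head => /esym/andP[wa _]; split=> // m.
  case/walk_short=> e' e'm /andP[lt we].
  have := M e'; rewrite lt we inE => /predU1P[<- //|le].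
  by apply: leq_trans e'm; apply: ltnW; apply: (allP (order_path_min ltn_trans al)).
split=> [/min //|[wd dmin]].
case E : (dist x y) => [e|].
  have [we emin] := min _ E; congr Some; apply/eqP.
  by rewrite eqn_leq emin // dmin.
have [e _ /andP[lt we]] := walk_short wd.
by move: E (M e); rewrite /dist we lt; case: [seq _ <- _ | _].
Qed.

Definition power_adj (H : sgraph) (k : nat) : rel H :=
  fun x y => (x != y) && (if dist x y is Some d then d <= k else false).

Lemma power_adj_sym H k : symmetric (@power_adj H k).
Proof. by move=> x y; rewrite /power_adj eq_sym dist_sym. Qed.

Lemma power_adj_irrefl H k : irreflexive (@power_adj H k).
Proof. by move=> x; rewrite /power_adj eqxx. Qed.

Definition power (H : sgraph) (k : nat) : sgraph :=
  SGraph (@power_adj_sym H k) (@power_adj_irrefl H k).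

Definition path_adj (n : nat) : rel 'I_n := fun i j => (i.+1 == j) || (j.+1 == i).

Lemma path_adj_sym n : symmetric (@path_adj n).
Proof. by move=> i j; rewrite /path_adj orbC. Qed.

Lemma path_adj_irrefl n : irreflexive (@path_adj n).
Proof. by move=> i; rewrite /path_adj orbb gtn_eqF. Qed.

Definition path_graph (n : nat) : sgraph :=
  SGraph (@path_adj_sym n) (@path_adj_irrefl n).

Definition mono_copy (s : nat) (G H : sgraph) (c : edge G -> 'I_s) : Prop :=
  exists (a : 'I_s) (f : H -> G), injective f /\
    forall x y : H, adj x y ->
      exists2 e : edge G, val e = [set f x; f y] & c e = a.

Definition arrows (s : nat) (G H : sgraph) : Prop :=
  forall c : edge G -> 'I_s, mono_copy H c.

(* [r] is the minimum of [#|edges G|] over all [G] with [arrows s G H]; kept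
   relational so that no junk value arises before the minimum is known to exist. *)
Definition is_size_ramsey (s : nat) (H : sgraph) (r : nat) : Prop :=
  (exists2 G : sgraph, arrows s G H & #|edges G| = r) /\
  (forall G : sgraph, arrows s G H -> r <= #|edges G|).

Lemma is_size_ramsey_uniq s H r1 r2 :
  is_size_ramsey s H r1 -> is_size_ramsey s H r2 -> r1 = r2.
Proof.
move=> [[G1 A1 <-] m1] [[G2 A2 <-] m2].
by apply/eqP; rewrite eqn_leq m1 // m2.
Qed.

(* Main.v *)
Require Import Defs.
From mathcomp Require Import all_boot.
From mathcomp Require Import zify.
From Stdlib Require Import Classical_Prop.

(** Fix an expander [e] of bounded degree on a set [V] of Theta(n) points, take
    the graph in which two points are joined when they are within [r] steps of
    each other, and replace every point by a clique on [t] vertices, adjacent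
    points giving complete bipartite graphs.  For constants [r] and [t] this
    [blowup] has O(n) edges ([card_edges_blowup]), and it arrows the [k]th power
    of the path on [n] vertices when [r] and [t] are large.

    The arrowing is proved by induction on the number of colours, for a
    statement, [blowup_ramsey], about the blow-up over any half [U] of [V], its
    points being placed anywhere in an ambient edge-coloured set.  The point of
    the formulation is that distances are always measured in the same expander
    [e], so that no structure has to be rebuilt when a colour is eliminated.
    In the inductive step ([blowup_ramseyS]):

    - Ramsey's theorem inside each [t]-clique and a majority vote give one colour
      [a] and, over every [v] in a set [W] of positive density, a large clique
      [B v] of colour [a] ([majority_cliques]).  Call [u] and [v] linked when
      there is a complete bipartite graph with [2 * k] vertices on both sides
      and colour [a] between [B u] and [B v].
    - A long path of linked points carries a [k]th power of a path in colour [a]: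
      inside every [B v], traverse [k] vertices of the biclique that links [v] to
      its predecessor and then [k] others of the biclique that links [v] to its
      successor ([linked_path_power]).
    - If there is no long path of linked points, depth-first search produces as
      many sets of positive density as desired with no links between them
      ([path_or_holes]).  Index these sets by pairs [(q, i)], where [q] is a colour
      of a proper colouring of the points within a given distance [r] of each
      other, and [i < t], for the [r] and [t] of the induction hypothesis.
      Expansion shows that at least half of all points [u] are within a constant
      distance of every one of the sets ([mostly_near_all]), however small their
      density is compared with the degree of the expander.  Such a point [u] is
      given, for every [i], a point [f (u, i)] nearby in the set of index
      [(q u, i)].  Two different [(u, i)] and [(u', i')] with [u] and [u'] within
      [r] then get unlinked points, and one can choose in every [B (f (u, i))] one
      vertex in such a way that no edge of colour [a] is left ([selection]).
      The vertices chosen form a blow-up of the same kind without colour [a].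

    Expanders come from counting: among all tuples of [d] maps of a set into
    itself, few miss some pair of sets of a fixed positive density
    ([expanding_functions]).  Deleting the points of high in-degree bounds the
    degree, and deleting a maximal set that does not expand makes all small sets
    expand ([prune_nonexpanding]). *)

Set Implicit Arguments.
Unset Strict Implicit.
Unset Printing Implicit Defensive.

(** * Counting in finite sets *)

Lemma card_bigcup_leq (I T : finType) (P : {set I}) (F : I -> {set T}) m :
  (forall i, i \in P -> #|F i| <= m) -> #|\bigcup_(i in P) F i| <= #|P| * m.
Proof.
move=> Fm; rewrite -sum_nat_const.
elim/big_rec2: _ => [|i n A iP An]; first by rewrite cards0.
by apply: leq_trans (leq_card_setU _ _) (leq_add (Fm i iP) An).
Qed.

(** * Distance *)

Fixpoint near (V : finType) (e : rel V) (r : nat) (u v : V) : bool :=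
  if r is r'.+1 then [exists w, near e r' u w && e w v] else u == v.

Section Near.
Variables (V : finType) (e : rel V).
Hypotheses (e_sym : symmetric e) (e_refl : reflexive e).

Lemma near_refl r u : near e r u u.
Proof. by elim: r => //= r IH; apply/existsP; exists u; rewrite IH e_refl. Qed.

Lemma near_add r1 r2 u v w :
  near e r1 u v -> near e r2 v w -> near e (r1 + r2) u w.
Proof.
move=> uv; elim: r2 w => [|r2 IH] w /=; first by rewrite addn0 => /eqP <-.
case/existsP=> z /andP[vz zw]; rewrite addnS /=.
by apply/existsP; exists z; rewrite IH.
Qed.

Lemma near_sym r : symmetric (near e r).
Proof.
suff S u v : near e r u v -> near e r v u by move=> u v; apply/idP/idP; apply: S.
elim: r v => [|r IH] v /=; first by rewrite eq_sym.
case/existsP=> w /andP[/IH uw wv]; apply: (near_add (r1 := 1)) uw => /=.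
by apply/existsP; exists v; rewrite eqxx e_sym.
Qed.

Lemma near_le r1 r2 u v : r1 <= r2 -> near e r1 u v -> near e r2 u v.
Proof. by move=> /subnKC <- uv; apply: near_add uv (near_refl _ _). Qed.

Lemma card_near b r u :
  (forall v, #|[set w | e v w]| <= b) -> #|[set v | near e r u v]| <= b ^ r.
Proof.
move=> deg; elim: r => [|r IH].
  by rewrite (_ : [set v | _] = [set u]) ?cards1 //; apply/setP=> v; rewrite !inE eq_sym.
have -> : [set v | near e r.+1 u v]
    = \bigcup_(w in [set w | near e r u w]) [set v | e w v].
  apply/setP=> v; rewrite inE /=; apply/existsP/bigcupP => [[w /andP[]]|[w]].
    by exists w; rewrite inE.
  by rewrite !inE => uw wv; exists w; rewrite uw.
apply: leq_trans (card_bigcup_leq (m := b) _) _ => //.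
by rewrite expnSr leq_mul2r IH orbT.
Qed.
End Near.

Lemma pigeonhole_cover (I T : finType) (S : {set T}) (F : I -> {set T}) m :
  (forall x, x \in S -> exists i, x \in F i) -> #|I| * m < #|S| ->
  exists i, m < #|S :&: F i|.
Proof.
move=> cov big; apply/existsP; apply: contraLR big.
rewrite negb_exists -leqNgt => /forallP small.
have -> : S = \bigcup_(i in [set: I]) (S :&: F i).
  apply/setP=> x; apply/idP/bigcupP => [xS|[i _]]; last by case/setIP.
  by have [i xi] := cov x xS; exists i; rewrite ?inE // xS.
by rewrite -cardsT; apply: card_bigcup_leq => i _; rewrite leqNgt small.
Qed.

Lemma subset_of_card (T : finType) (A : {set T}) n :
  n <= #|A| -> exists2 B : {set T}, B \subset A & #|B| = n.
Proof.
move=> nA; exists [set x in take n (enum A)].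
  by apply/subsetP=> x; rewrite inE => /mem_take; rewrite mem_enum.
have /card_uniqP : uniq (take n (enum A)) by rewrite take_uniq ?enum_uniq.
by rewrite cardsE size_takel // -cardE.
Qed.

(** * Ramsey's theorem *)

Section Ramsey.
Variables (T : finType) (s : nat) (R : 'I_s -> rel T).
Hypothesis R_sym : forall a, symmetric (R a).

Fixpoint ramsey_bound (n : nat) : nat :=
  if n is n'.+1 then (s * ramsey_bound n').+2 else 0.

(** The clique sizes aimed at may differ between colours, so that the induction
    is on their sum: among the neighbours of a point [x] in a popular colour [c]
    it suffices to find a clique of colour [c] with one vertex less. *)
Lemma ramsey n (m : 'I_s -> nat) (S : {set T}) :
  0 < s -> \sum_a m a <= n -> ramsey_bound n <= #|S| ->
  (forall x y, x \in S -> y \in S -> x != y -> exists a, R a x y) ->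
  exists a (B : {set T}), [/\ B \subset S, #|B| = m a
    & forall x y, x \in B -> y \in B -> x != y -> R a x y].
Proof.
move=> s_gt0; elim: n m S => [|n IH] m S mn nS cov.
all: have [/existsP[a /eqP ma0]|/existsPn nz] := boolP [exists a, m a == 0].
- by exists a, set0; rewrite sub0set cards0; split=> // x y; rewrite inE.
- move: mn; rewrite leqn0 sum_nat_eq0 => /forallP /(_ (Ordinal s_gt0)) /=.
  by rewrite (negPf (nz _)).
- by exists a, set0; rewrite sub0set cards0; split=> // x y; rewrite inE.
have /card_gt0P[x xS] : 0 < #|S| by apply: leq_trans nS.
have [c] : exists c, ramsey_bound n < #|(S :\ x) :&: [set y | R c x y]|.
  apply: pigeonhole_cover => [y /setD1P[yx yS]|].
    by have [|c xy] := cov x y xS yS; [rewrite eq_sym|exists c; rewrite inE].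
  by move: nS; rewrite (cardsD1 x S) xS card_ord.
set S' := _ :&: _ => /ltnW S'big.
have S'S : S' \subset S by apply: subset_trans (subsetIl _ _) (subD1set _ _).
(* [x] itself supplies one vertex of a clique of colour [c]. *)
pose m' a := if a == c then (m c).-1 else m a.
have [||a [B [BS' Bm' Bcl]]] := IH m' S' _ S'big.
- move: mn; rewrite (bigD1 c) //= [X in _ -> X <= _](bigD1 c) //= {1}/m' eqxx.
  rewrite (eq_bigr (F1 := m') m) => [|i /negPf ic]; last by rewrite /m' ic.
  by have := nz c; case: (m c).
- by move=> y z yS zS; apply: cov; apply: (subsetP S'S).
have BS := subset_trans BS' S'S.
have [ac|ac] := eqVneq a c; last first.
  by exists a, B; split=> //; rewrite Bm' /m' (negPf ac).
subst c.
have BP y : y \in B -> y != x /\ R a x y.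
  by move/(subsetP BS'); rewrite !inE => /andP[/andP[]].
exists a, (x |: B); split.
- by rewrite subUset sub1set xS.
- rewrite cardsU1 Bm' /m' eqxx; have := nz a.
  by case: (boolP (x \in B)) => [/BP[]|_]; rewrite ?eqxx //; case: (m a).
- move=> y z /setU1P[->|yB] /setU1P[->|zB]; rewrite ?eqxx // => yz.
  + by case: (BP z zB).
  + by rewrite R_sym; case: (BP y yB).
  + exact: Bcl.
Qed.
End Ramsey.

(** * Long paths or sets without edges between them *)

(** The states of a depth-first search: [S] holds the finished vertices and [p]
    is the current path, its active end first.  A vertex is finished only when
    it has no unvisited neighbour, so that finished and unvisited vertices are
    never adjacent; stopping when exactly [h] vertices are finished leaves all
    but [h + size p] vertices of [W] unvisited. *)
Lemma dfs (V : finType) (J : rel V) (W : {set V}) h : symmetric J -> h <= #|W| ->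
  exists (S : {set V}) (p : seq V),
    [/\ S \subset W, #|S| = h, uniq p, {subset p <= W :\: S} & sorted J p] /\
    (forall x y, x \in S -> y \in W -> y \notin S -> y \notin p -> ~~ J x y).
Proof.
move=> Jsym; elim: h => [_|h IH hW].
  exists set0, [::]; split; first by rewrite sub0set cards0.
  by move=> x y; rewrite inE.
have [S0 [p0]] := IH (ltnW hW).
have [n] := ubnP #|W :\: S0 :\: [set x in p0]|.
elim: n S0 p0 => // n IHn S p lt_n [[SW Sh pU pW pJ] SN].
(* Visiting a new vertex [y] decreases the number of unvisited vertices. *)
have push y : y \in W -> y \notin S -> y \notin p -> sorted J (y :: p) ->
    exists (S : {set V}) (p : seq V), [/\ S \subset W, #|S| = h.+1, uniq p,
                    {subset p <= W :\: S} & sorted J p] /\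
    (forall x y, x \in S -> y \in W -> y \notin S -> y \notin p -> ~~ J x y).
  move=> yW yS yp yJ; apply: (IHn S (y :: p)).
    rewrite ltnS in lt_n; apply: leq_trans lt_n; apply: proper_card; apply/properP; split.
      by apply/subsetP=> z; rewrite !inE negb_or -andbA => /and4P[_ -> -> ->].
    by exists y; rewrite !inE ?eqxx // yW yS yp.
  split; first split=> //=; first by rewrite yp.
    by move=> z; rewrite inE => /predU1P[->|/pW]; rewrite // inE yS.
  by move=> x z xS zW zS; rewrite inE negb_or => /andP[_]; apply: SN.
(* With an empty path the search restarts anywhere outside [S]. *)
case: p => [|x p] in lt_n pU pW pJ SN push *.
  have /subsetPn[y yW yS] : ~~ (W \subset S).
    by apply/negP=> /subset_leq_card; rewrite Sh leqNgt hW.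
  exact: (push y).
have [/existsP[y /and4P[yW yS yp xy]]|/existsPn no] :=
    boolP [exists y, [&& y \in W, y \notin S, y \notin x :: p & J x y]].
  by apply: (push y) => //=; rewrite Jsym xy.
(* No unvisited neighbour at the end [x] of the path: [x] is finished. *)
have /setDP[xW xS] : x \in W :\: S by apply: pW; rewrite mem_head.
exists (x |: S), p; split.
  split.
  - by rewrite subUset sub1set xW.
  - by rewrite cardsU1 xS Sh.
  - by case/andP: pU.
  - move=> y yp; have := pW y; rewrite !inE yp orbT negb_or => /(_ isT) /andP[-> ->].
    by rewrite !andbT; apply: contraTneq yp => ->; case/andP: pU.
  - exact: path_sorted pJ.
move=> y z /setU1P[-> {y}|yS] zW; rewrite !inE negb_or => /andP[zx zS] zp.
  by have := no z; rewrite zW zS inE negb_or zx zp.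
by apply: SN; rewrite // inE negb_or zx.
Qed.

(** Without a path on [h] vertices, each search cuts off a set of [h] vertices
    at the cost of fewer than [h] others, and goes on in the unvisited part. *)
Lemma path_or_holes (V : finType) (J : rel V) (W : {set V}) h (Q : eqType) (l : seq Q) :
  symmetric J -> uniq l -> size l * (h + h) <= #|W| ->
  (exists p, [/\ h <= size p, uniq p, {subset p <= W} & sorted J p]) \/
  (exists Vs : Q -> {set V},
     (forall q, q \in l -> Vs q \subset W /\ #|Vs q| = h) /\
     (forall q q' x y, q \in l -> q' \in l -> q != q' ->
        x \in Vs q -> y \in Vs q' -> x != y /\ ~~ J x y)).
Proof.
move=> Jsym; elim: l W => [|q l IH] W /=.
  by right; exists (fun _ => set0); split=> [q|q q' x y]; rewrite ?in_nil.
case/andP=> ql lU; rewrite mulSn => big.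
have hW : h <= #|W| by lia.
have [S [p [[SW Sh pU pW pJ] SN]]] := dfs Jsym hW.
have [hp|ph] := leqP h (size p).
  by left; exists p; split=> // x /pW /setDP[].
pose W' := W :\: S :\: [set x in p].
have W'W : W' \subset W by apply: subset_trans (subsetDl _ _) (subsetDl _ _).
have W'big : size l * (h + h) <= #|W'|.
  have : #|W| <= #|S| + #|W'| + size p.
    have -> : #|S| + #|W'| + size p = #|S| + #|[set x in p]| + #|W'|.
      have -> : #|[set x in p]| = size p by rewrite cardsE; apply/card_uniqP.
      by rewrite addnAC.
    apply: leq_trans (leq_add (leq_card_setU _ _) (leqnn _)).
    apply: leq_trans (leq_card_setU _ _); apply: subset_leq_card.
    by apply/subsetP=> x xW; rewrite !inE xW; case: (x \in S); case: (x \in p).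
  by rewrite Sh; lia.
have [[p' [hp' p'U p'W p'J]]|[Vs [VsP VsN]]] := IH W' lU W'big.
  by left; exists p'; split=> // x /p'W; apply: (subsetP W'W).
right; exists (fun q' => if q' == q then S else Vs q'); split=> [q'|].
  rewrite inE; case: eqP => [_ _|_ /= /VsP[sub ->]] //.
  by split=> //; apply: subset_trans W'W.
have SV q' x y : q' \in l -> x \in S -> y \in Vs q' -> x != y /\ ~~ J x y.
  move=> q'l xS yV; have [/subsetP/(_ y yV) + _] := VsP _ q'l.
  rewrite !inE => /and3P[yp yS yW]; split; last exact: SN.
  by apply: contraNneq yS => <-.
move=> q1 q2 x y; rewrite !inE.
case: eqP => [->|_] /= q1l; case: eqP => [->|_] /= q2l; rewrite ?eqxx //.
- by move=> _; apply: SV.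
- by move=> _ xV yS; rewrite eq_sym Jsym; apply: SV xV.
- exact: VsN.
Qed.

(** * Choosing representatives without conflict *)

Section Selection.
Variables (I K : finType) (k : nat) (F : I -> I -> rel K) (E : rel I).

Definition biclique_free (F : rel K) (A B : {set K}) :=
  forall X Y : {set K}, X \subset A -> Y \subset B -> #|X| = k -> #|Y| = k ->
  exists x y, [/\ x \in X, y \in Y & ~~ F x y].

(** If [k] vertices of [A] each missed less than [1 / (2 * k)] of [B], together they
    would miss at most half of [B], and the other half, of size at least [k],
    would span a biclique with them. *)
Lemma few_greedy (Q : rel K) (A B : {set K}) : 0 < k ->
  biclique_free Q A B -> 2 * k <= #|B| ->
  #|[set x in A | 2 * k * #|[set y in B | ~~ Q x y]| < #|B|]| < k.
Proof.
move=> k_gt0 free Bk; rewrite ltnNge; apply/negP => /subset_of_card[X Xbad Xk].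
pose C := \bigcup_(x in X) [set y in B | ~~ Q x y].
have C_small : 2 * #|C| <= #|B|.
  have /(leq_mul (leqnn (2 * k))) : #|C| <= k * (#|B| %/ (2 * k)).
    rewrite -Xk; apply: card_bigcup_leq => x xX.
    have := subsetP Xbad x xX; rewrite inE => /andP[_ /ltnW].
    by rewrite Xk leq_divRL ?muln_gt0 ?k_gt0 // mulnC.
  have := leq_trunc_div #|B| (2 * k); nia.
have /subset_of_card[Y Yrest Yk] : k <= #|B :\: C|.
  have := cardsID C B; have := subset_leq_card (subsetIr B C); lia.
have [||x [y [xX yY nQ]]] := free X Y _ _ Xk Yk.
- by apply/subsetP=> x /(subsetP Xbad); rewrite inE => /andP[].
- by apply: subset_trans Yrest (subsetDl _ _).
have := subsetP Yrest y yY; rewrite inE => /andP[/bigcupP[]].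
exists x; rewrite // inE nQ andbT.
by have := subsetP Yrest y yY; rewrite inE => /andP[].
Qed.

Lemma biclique_freeS (Q : rel K) (A A' B B' : {set K}) :
  A' \subset A -> B' \subset B -> biclique_free Q A B -> biclique_free Q A' B'.
Proof.
move=> AA BB free X Y XA YB; apply: free; [exact: subset_trans AA|exact: subset_trans BB].
Qed.

(** Greedy choice.  A representative [x] of [a] restricts each later set [A b] in
    conflict to the vertices that are not [F]-related to [x]; [few_greedy] allows a
    choice of [x] for which every such set keeps a fraction [1 / (2 * k)].  The
    exponent in the size condition counts the restrictions still to come. *)
Lemma selection_seq (x0 : K) D (l : seq I) (A : I -> {set K}) :
  0 < k -> symmetric E -> (forall a b x y, F a b x y = F b a y x) ->
  (forall a, #|[set b | E a b]| <= D) -> (forall a, ~~ E a a) ->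
  uniq l ->
  (forall a b, E a b -> biclique_free (F a b) (A a) (A b)) ->
  (forall a, a \in l ->
     (2 * k) ^ #|[set b in l | E a b]| * (2 * k * D.+1) <= #|A a|) ->
  exists g : I -> K, (forall a, a \in l -> g a \in A a) /\
    (forall a b, a \in l -> b \in l -> E a b -> ~~ F a b (g a) (g b)).
Proof.
move=> k_gt0 Esym Fsym deg Eirr.
elim: l A => [|a l IH] A /=; first by exists (fun _ => x0); split=> // a.
case/andP=> al lU free big.
have big0 b : b \in a :: l -> 2 * k * D.+1 <= #|A b|.
  by move/big; apply: leq_trans; rewrite leq_pmull // expn_gt0 muln_gt0 k_gt0.
pose B b := [set x in A a | 2 * k * #|[set y in A b | ~~ F a b x y]| < #|A b|].
pose N := [set b in l | E a b].
have : ~~ (A a \subset \bigcup_(b in N) B b).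
  apply/negP=> /subset_leq_card; apply/negP; rewrite -ltnNge.
  apply: leq_ltn_trans (card_bigcup_leq (m := k) _) _.
    move=> b; rewrite inE => /andP[bl ab]; apply: ltnW; apply: few_greedy => //.
      exact: free.
    apply: leq_trans (big0 b _); last by rewrite inE bl orbT.
    by rewrite leq_pmulr.
  apply: leq_trans (big0 a (mem_head _ _)).
  have : #|N| <= D.
    apply: leq_trans (deg a); apply/subset_leq_card/subsetP=> b.
    by rewrite !inE => /andP[].
  nia.
case/subsetPn=> x xA xB.
pose A' b := if E a b then [set y in A b | ~~ F a b x y] else A b.
have A'A b : A' b \subset A b.
  by rewrite /A'; case: ifP => // _; apply/subsetP=> y; rewrite inE => /andP[].
have [//||b bl|g [gA gF]] := IH A'.
- by move=> b c bc; apply: biclique_freeS (free b c bc).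
- have := big b; rewrite inE bl orbT => /(_ isT).
  have [ab|ab] := boolP (E a b); rewrite /A' ?ab ?(negPf ab); last first.
    rewrite (_ : [set c in a :: l | _] = [set c in l | E b c]) //.
    by apply/setP=> c; rewrite !inE; case: eqP => //= ->; rewrite Esym (negPf ab) andbF.
  rewrite (_ : [set c in a :: l | _] = a |: [set c in l | E b c]); last first.
    by apply/setP=> c; rewrite !inE; case: eqP => //= ->; rewrite Esym ab.
  rewrite cardsU1 inE (negPf al) /= expnS -mulnA => Ab.
  have : ~~ (x \in B b).
    by apply: contra xB => xBb; apply/bigcupP; exists b; rewrite // inE bl.
  rewrite inE xA /= -leqNgt => /(leq_trans Ab).
  by rewrite leq_pmul2l // muln_gt0.
exists (fun b => if b == a then x else g b); split=> [b|b c].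
  by rewrite inE; case: eqP => [-> //|_ /= /gA]; apply: (subsetP (A'A b)).
have aF c' : c' \in l -> E a c' -> ~~ F a c' x (g c').
  by move=> /gA + ac; rewrite /A' ac inE => /andP[].
rewrite !inE; case: eqP => [->|_] /=; case: eqP => [->|_] /=.
- by move=> _ _; rewrite (negPf (Eirr a)).
- by move=> _; apply: aF.
- by move=> bl _ ba; rewrite Fsym; apply: aF; rewrite // Esym.
- exact: gF.
Qed.

Lemma selection (x0 : K) D (A : I -> {set K}) :
  0 < k -> symmetric E -> (forall a b x y, F a b x y = F b a y x) ->
  (forall a, #|[set b | E a b]| <= D) -> (forall a, ~~ E a a) ->
  (forall a b, E a b -> biclique_free (F a b) (A a) (A b)) ->
  (forall a, (2 * k) ^ D * (2 * k * D.+1) <= #|A a|) ->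
  exists g : I -> K, (forall a, g a \in A a) /\
    (forall a b, E a b -> ~~ F a b (g a) (g b)).
Proof.
move=> k_gt0 Esym Fsym deg Eirr free big.
have [|a _|g [gA gF]] := selection_seq (l := enum I) x0 k_gt0 Esym Fsym deg Eirr _ free.
- exact: enum_uniq.
- apply: leq_trans (big a); rewrite leq_mul2r leq_exp2l; last by lia.
  apply/orP; right; apply: leq_trans (deg a); apply/subset_leq_card/subsetP=> b.
  by rewrite !inE => /andP[].
by exists g; split=> [a|a b]; [apply: gA|apply: gF]; rewrite mem_enum.
Qed.
End Selection.

(** Equality has no biclique with two vertices on each side, so greedy colouring
    is a case of [selection].  The number of colours must not depend on the graph:
    it fixes the number of sets needed in [blowup_ramseyS] before the graph is
    known. *)
Lemma proper_colouring D : exists n, forall (I : finType) (E : rel I),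
  symmetric E -> (forall a, #|[set b | E a b]| <= D) -> (forall a, ~~ E a a) ->
  exists q : I -> 'I_n, forall a b, E a b -> q a != q b.
Proof.
exists (4 ^ D * (4 * D.+1)) => I E Esym deg Eirr.
have c_gt0 : 0 < 4 ^ D * (4 * D.+1) by rewrite muln_gt0 expn_gt0.
have [|||g [_ gP]] := @selection I 'I_(4 ^ D * (4 * D.+1)) 2
  (fun _ _ => eq_op) E (Ordinal c_gt0) D (fun=> setT) isT Esym _ deg Eirr.
- by move=> a b x y; rewrite eq_sym.
- move=> a b _ X Y _ _ X2 Y2.
  have /card_gt0P[y yY] : 0 < #|Y| by rewrite Y2.
  have /cards2P[x [x' [xx' XE]]] : #|X| == 2 by rewrite X2.
  have [E1|xy] := eqVneq x y; last by exists x, y; rewrite XE !inE eqxx.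
  by exists x', y; rewrite XE !inE eqxx orbT; split=> //; rewrite -E1 eq_sym.
- by move=> a; rewrite cardsT card_ord.
by exists g.
Qed.

(** * Powers of paths as sequences *)

Fixpoint power_path (T : Type) (k : nat) (Q : rel T) (s : seq T) : bool :=
  if s is x :: s' then all (Q x) (take k s') && power_path k Q s' else true.

Lemma power_path_nth (T : Type) k (Q : rel T) s x0 i j : power_path k Q s ->
  i < j -> j <= i + k -> j < size s -> Q (nth x0 s i) (nth x0 s j).
Proof.
elim: s i j => [|x s IH] [|i] [|j] //=; last first.
  by case/andP=> _ sQ ij jk js; apply: IH.
case/andP=> /(all_nthP x0) xQ _ _ jk js; rewrite add0n in jk.
have := xQ j; rewrite nth_take //; apply.
by rewrite size_take; case: ifP => // _.
Qed.

Lemma map_power_path (T T' : Type) (f : T -> T') k (Q : rel T') s :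
  power_path k (relpre f Q) s -> power_path k Q (map f s).
Proof. by elim: s => //= x s IH /andP[xs /IH ->]; rewrite -map_take all_map xs. Qed.

Lemma pairwise_power_path (T : eqType) n (P : rel T) (s : seq T) :
  pairwise P s -> power_path n P s.
Proof.
elim: s => //= x s IH /andP[xs /IH ->]; rewrite andbT.
by apply/allP=> y /mem_take /(allP xs).
Qed.

Lemma power_path_cat (T : eqType) k (Q : rel T) (c d r : seq T) :
  size c <= k -> k <= size d ->
  pairwise Q c -> allrel Q c d -> power_path k Q (d ++ r) ->
  power_path k Q (c ++ d ++ r).
Proof.
move=> + dk; elim: c => //= x c IH ck /andP[xc cQ].
rewrite allrel_consl => /andP[xd cd] dr.
rewrite IH ?(ltnW ck) // andbT catA takel_cat; last by rewrite size_cat; lia.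
by apply/allP=> y /mem_take; rewrite mem_cat => /orP[/(allP xc)|/(allP xd)].
Qed.

(** * Powers of paths along linked points *)

Section Chain.
Variables (V K : finType) (k : nat) (Q : rel (V * K)) (B : V -> {set K}).

(** The bicliques have [2 * k] vertices on each side, so that after [k] vertices of
    [B u] are used up on one side of [u], [k] others are available on the next. *)
Definition linked (u v : V) : bool :=
  [exists A : {set K}, exists A' : {set K},
    [&& A \subset B u, A' \subset B v, #|A| == 2 * k, #|A'| == 2 * k
      & [forall x in A, forall y in A', Q (u, x) (v, y)]]].

Lemma linked_sym : symmetric Q -> symmetric linked.
Proof.
move=> Qsym.
suff S u v : linked u v -> linked v u by move=> u v; apply/idP/idP; apply: S.
case/existsP=> A /existsP[A' /and5P[Au A'v Ak A'k /forall_inP AA']].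
apply/existsP; exists A'; apply/existsP; exists A; apply/and5P; split=> //.
by apply/forall_inP=> y yA'; apply/forall_inP=> x /AA' /forall_inP; rewrite Qsym; apply.
Qed.

Definition fibre (v : V) (S : {set K}) : seq (V * K) := [seq (v, x) | x <- enum S].

Lemma size_fibre v S : size (fibre v S) = #|S|.
Proof. by rewrite size_map -cardE. Qed.

Lemma mem_fibre v S c : (c \in fibre v S) = (c.1 == v) && (c.2 \in S).
Proof.
apply/mapP/andP => [[x]|[/eqP <- cS]]; first by rewrite mem_enum => xS -> /=.
by exists c.2; rewrite ?mem_enum //; case: c {cS}.
Qed.

Lemma uniq_fibre v S : uniq (fibre v S).
Proof. by rewrite map_inj_uniq ?enum_uniq // => x y []. Qed.

Lemma pairwise_fibre v (A : {set K}) :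
  (forall x y, x \in A -> y \in A -> x != y -> Q (v, x) (v, y)) ->
  pairwise Q (fibre v A).
Proof.
move=> clique; have : {subset enum A <= A} by move=> x; rewrite mem_enum.
rewrite /fibre; elim: (enum A) (enum_uniq A) => //= x l IH /andP[xl lU] lA.
rewrite IH // => [|y yl]; last by rewrite lA // inE yl orbT.
rewrite andbT all_map; apply/allP=> y yl /=; apply: clique.
- by rewrite lA ?mem_head.
- by rewrite lA // inE yl orbT.
- by apply: contraNneq xl => ->.
Qed.

(** Over every point [v] of the path the sequence visits two disjoint [k]-subsets
    of [B v]: the set [S], completely joined to what comes before, and a set
    inside the biclique that links [v] to the next point.  Consecutive blocks of
    length [k] are then completely joined, which makes the sequence a [k]th power
    of a path. *)
Lemma linked_path_power (v : V) (p : seq V) (S : {set K}) : 0 < k ->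
  (forall u, u \in v :: p -> forall x y, x \in B u -> y \in B u -> x != y ->
     Q (u, x) (u, y)) ->
  uniq (v :: p) -> path linked v p -> S \subset B v -> #|S| = k ->
  exists r, [/\ uniq (fibre v S ++ r), power_path k Q (fibre v S ++ r),
    size p < size (fibre v S ++ r) &
    forall c, c \in fibre v S ++ r -> (c.1 \in v :: p) && (c.2 \in B c.1)].
Proof.
move=> k_gt0; elim: p v S => [|w p IH] v S clique.
  move=> _ _ SB Sk; exists [::]; rewrite cats0 uniq_fibre size_fibre Sk; split=> //.
    apply/pairwise_power_path/pairwise_fibre => x y xS yS; apply: clique.
    - exact: mem_head.
    - exact: (subsetP SB).
    - exact: (subsetP SB).
  by move=> c; rewrite mem_fibre inE => /andP[/eqP -> /(subsetP SB) ->]; rewrite eqxx.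
have pairwiseQ (A : {set K}) : A \subset B v -> pairwise Q (fibre v A).
  move=> /subsetP AB; apply: pairwise_fibre => x y xA yA.
  by apply: clique; rewrite ?mem_head ?AB.
rewrite cons_uniq => /andP[vp pU] /= /andP[vw wp] SB Sk.
case/existsP: vw => A /existsP[A' /and5P[Av A'w /eqP Ak /eqP A'k /forall_inP AA']].
have /subset_of_card[Y YA Yk] : k <= #|A :\: S|.
  by have := cardsID S A; have := subset_leq_card (subsetIr A S); lia.
have YAP x : x \in Y -> x \in A /\ x \notin S.
  by move=> /(subsetP YA); rewrite inE => /andP[].
have /subset_of_card[S' S'A' S'k] : k <= #|A'| by lia.
have [||r [rU rQ rp rB]] := IH w S' _ pU wp _ S'k.
- by move=> u up; apply: clique; rewrite inE up orbT.
- exact: subset_trans A'w.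
have YB : Y \subset B v.
  by apply: subset_trans YA (subset_trans (subsetDl _ _) Av).
have newP c : c \in fibre w S' ++ r -> c.1 != v.
  by move=> /rB /andP[cp _]; apply: contraNneq vp => <-.
exists (fibre v Y ++ fibre w S' ++ r); split.
- rewrite cat_uniq uniq_fibre /= cat_uniq uniq_fibre rU andbT /=.
  apply/andP; split; apply/hasPn=> c; rewrite ?mem_cat mem_fibre.
    case/orP=> [/andP[/eqP cv /YAP[_ cS]]|]; first by rewrite mem_fibre cv eqxx.
    by rewrite -mem_cat mem_fibre => /newP /negPf ->.
  by rewrite -mem_fibre -mem_cat mem_fibre => /newP /negPf ->.
- apply: power_path_cat; rewrite ?size_fibre ?Sk ?Yk //; first exact: pairwiseQ.
    apply/allrelP=> -[c1 c2] [d1 d2]; rewrite !mem_fibre /=.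
    move=> /andP[/eqP -> cS] /andP[/eqP -> dY].
    apply: (clique v); rewrite ?mem_head ?(subsetP SB _ cS) ?(subsetP YB _ dY) //.
    by apply: contraTneq cS => ->; case: (YAP d2 dY).
  apply: power_path_cat; rewrite ?size_fibre ?Yk ?S'k //; first exact: pairwiseQ.
  apply/allrelP=> -[c1 c2] [d1 d2]; rewrite !mem_fibre /=.
  move=> /andP[/eqP -> cY] /andP[/eqP -> dS].
  have /AA' /forall_inP : c2 \in A by case: (YAP c2 cY).
  by apply; apply: (subsetP S'A').
- rewrite size_cat size_fibre Sk size_cat size_fibre Yk /=.
  by move: rp k_gt0; clear; lia.
- move=> c; rewrite mem_cat mem_fibre => /orP[/andP[/eqP -> /(subsetP SB) ->]|].
    by rewrite mem_head.
  rewrite mem_cat mem_fibre => /orP[/andP[/eqP -> /(subsetP YB) ->]|].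
    by rewrite mem_head.
  by case/rB/andP=> cp ->; rewrite inE cp orbT.
Qed.
End Chain.

(** * Expanders *)

(** Quantifying over all [mu] is essential: the bound on the distance depends on
    [mu] alone, whereas the values of [mu] in [blowup_ramseyS] are chosen large
    compared with the degree of the graph. *)
Definition spreading (V : finType) (e : rel V) : Prop :=
  forall mu (Z W : {set V}), 0 < #|V| -> #|V| <= mu * #|Z| -> #|V| <= mu * #|W| ->
  exists z w, [/\ z \in Z, w \in W & near e (2 * mu).+1 z w].

Definition expander (b : nat) (V : finType) (e : rel V) : Prop :=
  [/\ symmetric e, reflexive e, forall v, #|[set w | e v w]| <= b & spreading e].

(** The points far from a given [Vs i] have density less than [1 / mu], for otherwise
    they would be within reach of [Vs i]. *)
Lemma mostly_near_all (V I : finType) (e : rel V) mu (Vs : I -> {set V}) :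
  spreading e -> 0 < #|V| -> 2 * #|I| <= mu -> 0 < mu ->
  (forall i, #|V| <= mu * #|Vs i|) ->
  exists U : {set V}, #|V| <= 2 * #|U| /\
    forall u i, u \in U -> exists2 v, v \in Vs i & near e (2 * mu).+1 u v.
Proof.
move=> spr V_gt0 Imu mu_gt0 big.
pose far i := [set u | [forall v in Vs i, ~~ near e (2 * mu).+1 u v]].
exists (~: \bigcup_(i in [set: I]) far i); split; last first.
  move=> u i; rewrite inE => ufar.
  have /forall_inPn[v vV] : ~~ [forall v in Vs i, ~~ near e (2 * mu).+1 u v].
    by apply: contra ufar => ui; apply/bigcupP; exists i; rewrite ?inE.
  by rewrite negbK; exists v.
have far_small i : #|far i| <= #|V| %/ mu.
  rewrite leq_divRL // mulnC leqNgt; apply/negP=> /ltnW fbig.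
  have [u [v [uf vV uv]]] := spr mu _ _ V_gt0 fbig (big i).
  by move: uf; rewrite inE => /forall_inP /(_ v vV); rewrite uv.
have := card_bigcup_leq (P := [set: I]) (F := far) (fun i _ => far_small i).
rewrite cardsT => U_small; have := cardsC (\bigcup_(i in [set: I]) far i).
have := leq_trunc_div #|V| mu; have := leq_mul Imu (leqnn (#|V| %/ mu)).
rewrite -mulnA mulnC; lia.
Qed.

(** * Eliminating a colour *)

Section Majority.
Variables (V X : finType) (s t T : nat) (R : 'I_s -> rel X) (C : {set 'I_s}).
Variables (U : {set V}) (phi : V -> 'I_t -> X).

Lemma majority_cliques m :
  0 < s -> 1 < T -> ramsey_bound s (s * T) <= t ->
  (forall a, symmetric (R a)) ->
  (forall u i i', u \in U -> i != i' ->
     exists2 a, a \in C & R a (phi u i) (phi u i')) ->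
  s * m < #|U| ->
  exists a (W : {set V}) (B : V -> {set 'I_t}), [/\ a \in C, W \subset U, m < #|W|,
    forall v, v \in W -> #|B v| = T
    & forall v x y, v \in W -> x \in B v -> y \in B v -> x != y ->
        R a (phi v x) (phi v y)].
Proof.
move=> s_gt0 T_gt1 tbig Rsym cov Ubig.
pose mono v (c : 'I_s * {set 'I_t}) := v \in U -> [/\ c.1 \in C, #|c.2| = T
   & forall x y, x \in c.2 -> y \in c.2 -> x != y -> R c.1 (phi v x) (phi v y)].
have [|f fP] := @fin_all_exists V (fun=> _) mono.
  move=> v; have [vU|vU] := boolP (v \in U); last first.
    by exists (Ordinal s_gt0, set0) => vU'; rewrite vU' in vU.
  pose R' a x y := (a \in C) && R a (phi v x) (phi v y).
  have [|||x y _ _ xy|a [B [_ BT Bcl]]] :=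
      @ramsey _ s R' _ (s * T) (fun=> T) [set: 'I_t] s_gt0.
  - by move=> a x y; rewrite /R' Rsym.
  - by rewrite sum_nat_const card_ord.
  - by rewrite cardsT card_ord.
  - by have [a aC Ra] := cov v x y vU xy; exists a; rewrite /R' aC.
  exists (a, B) => _ /=.
  (* An edge of the clique witnesses that its colour belongs to [C]. *)
  have /card_gt1P[x [y [xB yB xy]]] : 1 < #|B| by rewrite BT.
  have /andP[aC _] := Bcl x y xB yB xy; split=> // x' y' x'B y'B x'y'.
  by case/andP: (Bcl x' y' x'B y'B x'y').
have [a aW] : exists a, m < #|U :&: [set v | (f v).1 == a]|.
  apply: pigeonhole_cover; last by rewrite card_ord.
  by move=> v _; exists (f v).1; rewrite inE.
have WP v : v \in U :&: [set v | (f v).1 == a] -> (f v).1 = a /\ mono v (f v).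
  by rewrite !inE => /andP[_ /eqP].
exists a, (U :&: [set v | (f v).1 == a]), (fun v => (f v).2); split=> //.
- have /card_gt0P[v vW] : 0 < #|U :&: [set v | (f v).1 == a]| by apply: leq_trans aW.
  by have [<- /(_ (subsetP (subsetIl _ _) _ vW)) []] := WP v vW.
- exact: subsetIl.
- by move=> v vW; have [_ /(_ (subsetP (subsetIl _ _) _ vW)) []] := WP v vW.
- move=> v x y vW; have [<- /(_ (subsetP (subsetIl _ _) _ vW)) []] := WP v vW.
  by move=> _ _ cl; apply: cl.
Qed.
End Majority.

(** The colour classes are arbitrary relations [R a], which may overlap, and only
    those with [a] in [C] are used to cover the edges of the blow-up.  The blow-up
    lives over a subset [U] of the expander and is embedded by [phi] in a set [X]:
    this makes the statement hereditary, since the induction replaces [U] and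
    [phi] but keeps [V], [e], [X] and [R]. *)
Definition blowup_ramsey (k s b j r t L N : nat) : Prop :=
  forall (V X : finType) (e : rel V) (R : 'I_s -> rel X) (C : {set 'I_s})
    (U : {set V}) (phi : V -> 'I_t -> X),
  expander b e -> N <= #|V| -> #|V| <= 2 * #|U| ->
  (forall a, symmetric (R a)) -> #|C| = j ->
  (forall u v i i', u \in U -> v \in U -> phi u i = phi v i' -> (u, i) = (v, i')) ->
  (forall u v i i', u \in U -> v \in U -> near e r u v -> (u, i) != (v, i') ->
     exists2 a, a \in C & R a (phi u i) (phi v i')) ->
  exists a p, [/\ uniq p, power_path k (R a) p & #|V| <= L * size p].

(** Without colours there can be no edge, but a point blown up into two vertices
    has one. *)
Lemma blowup_ramsey0 k s b : blowup_ramsey k s b 0 0 2 0 1.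
Proof.
move=> V X e R C U phi _ V_gt0 VU _ /eqP; rewrite cards_eq0 => /eqP -> _ cov.
have /card_gt0P[u uU] : 0 < #|U| by lia.
have [||a] := cov u u ord0 ord_max uU uU; rewrite ?inE //=.
by apply/eqP=> -[].
Qed.

(** The constants are chosen in this order: the number [Dq] of colours of a proper
    colouring for distance [r], hence the number [M] of pairwise unlinked sets
    needed, hence their density [1 / mu] and the distance [rho] from which almost
    all points reach them, hence the degree [D] of the conflicts to be resolved,
    hence the size [T] of the cliques [B v]. *)
Lemma blowup_ramseyS k s b j r t L N : 0 < k -> 0 < t ->
  blowup_ramsey k s b j r t L N ->
  exists r' t' L' N', 0 < t' /\ blowup_ramsey k s b j.+1 r' t' L' N'.
Proof.
move=> k_gt0 t_gt0 IH.
have [Dq colouring] := proper_colouring (b ^ r).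
pose M := Dq * t.
have [c [c_gt0 cM Mc]] : exists c, [/\ 0 < c, 4 * (s * M) < c & M <= c].
  by exists (4 * (s * M) + M).+1; split; lia.
pose mu := 2 * c.
pose rho := (2 * mu).+1.
have [r' r'E] : exists r', r' = rho + r + rho by eexists.
pose D := b ^ r' * t.
have [T [T_gt1 k2T TD]] : exists T,
    [/\ 1 < T, 2 * k <= T & (2 * (2 * k)) ^ D * (2 * (2 * k) * D.+1) <= T].
  by exists ((2 * (2 * k)) ^ D * (2 * (2 * k) * D.+1) + 2 * k); split; lia.
have [t' t'T] : exists t', ramsey_bound s (s * T) <= t'.+1.
  by exists (ramsey_bound s (s * T)).
exists r', t'.+1, (mu + L), (maxn N c); split=> //.
move=> V X e R C U phi [e_sym e_refl deg spr].
rewrite geq_max => /andP[NV cV] VU Rsym Cj inj cov.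
have V_gt0 : 0 < #|V| by apply: leq_trans cV.
have s_gt0 : 0 < s.
  have /card_gt0P[a _] : 0 < #|C| by rewrite Cj.
  exact: leq_ltn_trans (ltn_ord a).
pose h := #|V| %/ c.
have h_gt0 : 0 < h by rewrite divn_gt0.
have chV : c * h <= #|V| by rewrite mulnC leq_trunc_div.
have Vmuh : #|V| <= mu * h.
  have := ltn_ceil #|V| c_gt0; rewrite -/h mulSn mulnC /mu -mulnA.
  by have := leq_mul (leqnn c) h_gt0; lia.
have Ubig : s * (M * (h + h)) < #|U|.
  have : 4 * (s * M) * h < c * h by rewrite ltn_pmul2r.
  rewrite addnn -muln2; lia.
have [|a [W [B [aC WU Wbig BT Bcl]]]] :=
    majority_cliques (C := C) (phi := phi) s_gt0 T_gt1 t'T Rsym _ Ubig.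
  move=> u i i' uU ii'; apply: cov => //; first exact: near_refl.
  by apply: contraNneq ii' => -[->].
have {}WU : {subset W <= U} by apply/subsetP.
pose Q (c d : V * 'I_t'.+1) := R a (phi c.1 c.2) (phi d.1 d.2).
have Qsym : symmetric Q by move=> x y; apply: Rsym.
(* A long path of linked points gives the power of a path; otherwise there are
   sets [Vs i] without links between them. *)
pose J := linked k Q B.
have Jsym : symmetric J by apply: linked_sym.
have [|[p [hp pU pW pJ]]|[Vs [VsW VsJ]]] :=
    path_or_holes (W := W) (h := h) Jsym (enum_uniq {: 'I_Dq * 'I_t}).
- by rewrite -cardE card_prod !card_ord ltnW.
- case: p => [|v p] in hp pU pW pJ *; first by rewrite leqNgt h_gt0 in hp.
  have [S SB Sk] : exists2 S : {set 'I_t'.+1}, S \subset B v & #|S| = k.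
    by apply: subset_of_card; rewrite BT ?pW ?mem_head //; lia.
  have [|z [zU zQ zp zB]] := linked_path_power (Q := Q) k_gt0 _ pU pJ SB Sk.
    by move=> u /pW uW x y; apply: Bcl.
  move: (fibre v S ++ z) zU zQ zp zB => {z} z zU zQ zp zB.
  exists a, (map (fun c => phi c.1 c.2) z); split.
  - rewrite map_inj_in_uniq // => -[u i] [u' i'] /zB /= /andP[/pW /WU uU _].
    by move=> /zB /= /andP[/pW /WU u'U _]; apply: inj.
  - exact: map_power_path.
  - rewrite size_map; apply: leq_trans Vmuh _; apply: leq_mul (leq_addr _ _) _.
    by apply: leq_trans hp _.
have [|u|u|q qP] := colouring V (fun u v => (u != v) && near e r u v).
- by move=> u v /=; rewrite eq_sym near_sym.
- apply: leq_trans (card_near r u deg); apply/subset_leq_card/subsetP=> v.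
  by rewrite !inE => /andP[].
- by rewrite eqxx.
have VsP i : Vs i \subset W /\ #|Vs i| = h by apply: VsW; rewrite mem_enum.
have {}VsJ i i' x y : i != i' -> x \in Vs i -> y \in Vs i' -> x != y /\ ~~ J x y.
  by apply: VsJ; rewrite mem_enum.
have [|||U' [U'big U'near]] := mostly_near_all (mu := mu) (Vs := Vs) spr V_gt0.
- by rewrite card_prod !card_ord /mu leq_mul2l.
- by rewrite /mu muln_gt0.
- by move=> i; case: (VsP i) => _ ->.
have /card_gt0P[w0 w0W] : 0 < #|W| by apply: leq_ltn_trans Wbig.
have [|f fP] := @fin_all_exists (V * 'I_t)%type (fun=> V) (fun i v =>
    v \in W /\ (i.1 \in U' -> v \in Vs (q i.1, i.2) /\ near e rho i.1 v)).
  move=> -[u i] /=; have [uU|uU] := boolP (u \in U'); last first.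
    by exists w0; split=> // uU'; rewrite uU' in uU.
  have [v vV uv] := U'near u (q u, i) uU; exists v; split=> //.
  by apply: (subsetP (VsP _).1 v vV).
have fW i : f i \in W by case: (fP i).
(* A conflict is an edge of colour [a], or one vertex chosen twice; only indices
   at distance at most [r'] can choose from the same clique. *)
pose E (i i' : V * 'I_t) := [&& i.1 \in U', i'.1 \in U', i != i' & near e r' i.1 i'.1].
pose F i i' x y := near e r i.1 i'.1 && R a (phi (f i) x) (phi (f i') y)
                   || (f i == f i') && (x == y).
have k2_gt0 : 0 < 2 * k by lia.
have [|||||i|g [gB gF]] := @selection _ _ (2 * k) F E ord0 D (fun i => B (f i)) k2_gt0.
- by move=> i i'; rewrite /E eq_sym near_sym // andbCA.
- by move=> i i' x y; rewrite /F near_sym // Rsym (eq_sym (f i)) (eq_sym x).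
- move=> i; apply: (@leq_trans #|setX [set u | near e r' i.1 u] [set: 'I_t]|).
    by apply/subset_leq_card/subsetP=> i'; rewrite !inE => /and4P[_ _ _ ->].
  by rewrite cardsX cardsT card_ord leq_mul2r card_near ?orbT.
- by move=> i; rewrite /E eqxx !andbF.
- move=> i i' /and4P[iU i'U ii' _] A A' AB A'B Ak A'k.
  have [near_r|far_r] := boolP (near e r i.1 i'.1); last first.
    have /card_gt0P[y yA'] : 0 < #|A'| by rewrite A'k.
    have /card_gt0P[x] : 0 < #|A :\ y| by have := cardsD1 y A; rewrite Ak; lia.
    by case/setD1P=> xy xA; exists x, y; rewrite /F (negPf far_r) (negPf xy) andbF.
  have [ff nJ] : f i != f i' /\ ~~ J (f i) (f i').
    have [_ /(_ iU)[fi _]] := fP i; have [_ /(_ i'U)[fi' _]] := fP i'.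
    apply: VsJ fi fi'; apply: contra ii' => /eqP[qq i2].
    apply/eqP; case: i i' near_r qq i2 {iU i'U AB A'B} => [u j1] [u' j1'] /=.
    move=> near_r qq -> ; congr (_, _); apply/eqP; apply: contraTT isT => uu'.
    by have := qP u u'; rewrite uu' near_r qq eqxx => /(_ isT).
  have : ~~ [forall x in A, forall y in A', Q (f i, x) (f i', y)].
    apply: contra nJ => AA'; apply/existsP; exists A; apply/existsP; exists A'.
    by rewrite AB A'B Ak A'k eqxx.
  case/forall_inPn=> x xA /forall_inPn[y yA' nQ].
  by exists x, y; rewrite /F (negPf ff) orbF near_r.
- by rewrite BT.
have f_near u i : u \in U' -> near e rho u (f (u, i)).
  by move=> uU; case: (fP (u, i)) => _ /(_ uU)[].
have pair_inj u v i i' : u \in U' -> v \in U' -> (u, i) != (v, i') ->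
    (f (u, i), g (u, i)) != (f (v, i'), g (v, i')).
  move=> uU vU ne; apply/eqP=> -[ff gg].
  have uv : near e r' u v.
    apply: (@near_le _ _ e_refl (rho + rho)); first by rewrite r'E; lia.
    by apply: near_add (f_near u i uU) _; rewrite ff near_sym // f_near.
  have := gF (u, i) (v, i'); rewrite /E /= uU vU ne uv => /(_ isT).
  by rewrite /F ff gg !eqxx orbT.
have [||||a' [p [pU pQ pV]]] := IH V X e R (C :\ a) U'
    (fun u i => phi (f (u, i)) (g (u, i))) _ NV U'big Rsym.
- by split.
- by have := cardsD1 a C; rewrite aC Cj => -[].
- move=> u v i i' uU vU eq_phi; apply/eqP; apply: contraTT isT => ne.
  have := pair_inj u v i i' uU vU ne.
  by rewrite (inj _ _ _ _ (WU _ (fW _)) (WU _ (fW _)) eq_phi) eqxx.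
- move=> u v i i' uU vU uv ne.
  have ff : near e r' (f (u, i)) (f (v, i')).
    rewrite r'E; apply: near_add (f_near v i' vU); apply: near_add uv.
    by rewrite near_sym // f_near.
  have [a0 a0C Ra0] :=
    cov _ _ _ _ (WU _ (fW _)) (WU _ (fW _)) ff (pair_inj u v i i' uU vU ne).
  exists a0 => //; rewrite !inE a0C andbT; apply: contraTneq Ra0 => ->.
  have := gF (u, i) (v, i'); rewrite /E /= uU vU ne (near_le e_refl _ uv).
    by move=> /(_ isT); rewrite /F /= uv negb_or => /andP[].
  by rewrite r'E; lia.
exists a', p; split=> //.
by apply: leq_trans pV _; rewrite leq_mul2r leq_addl orbT.
Qed.

(** * Existence of expanders *)

Lemma bernoulli_succ a : 0 < a -> 2 * a ^ a <= a.+1 ^ a.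
Proof.
move=> a_gt0; rewrite -(leq_pmul2l a_gt0).
suff B n : a ^ n * (a + n) <= a * a.+1 ^ n.
  by apply: leq_trans (B a); move: (a ^ a) => x; nia.
elim: n => [|n IH]; first by rewrite !expn0 addn0 mul1n muln1.
rewrite !expnS; move: (a ^ n) (a.+1 ^ n) IH => x y IH.
have : a.+1 * (x * (a + n)) <= a.+1 * (a * y) by rewrite leq_mul2l IH orbT.
nia.
Qed.

Lemma card_avoiding (D T : finType) (d : nat) (S : {set D}) (Y : {set T}) :
  #|[set F : {ffun 'I_d * D -> T} | [forall j, forall x in S, F (j, x) \notin Y]]|
    = ((#|T| - #|Y|) ^ #|S| * #|T| ^ (#|D| - #|S|)) ^ d.
Proof.
rewrite cardsE.
pose G (i : 'I_d * D) : pred T := fun y => (i.2 \in S) ==> (y \notin Y).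
rewrite (eq_card (B := family G)); last first.
  move=> F; rewrite !inE; apply/forallP/familyP => [H [j x]|H j].
    by rewrite unfold_in; apply/implyP=> xS; have /forall_inP /(_ x xS) := H j.
  by apply/forall_inP=> x xS; have := H (j, x); rewrite unfold_in /G /= xS.
rewrite card_family foldrE big_map big_enum /=.
rewrite -(pair_bigA _ (fun j x => #|G (j, x)|)) /=.
under eq_bigr => j _.
  rewrite (bigID (mem S)) /=.
  rewrite (eq_bigr (fun=> #|T| - #|Y|)); last first.
    move=> x xS; have <- : #|~: Y| = #|T| - #|Y| by rewrite cardsCs setCK.
    by apply: eq_card => y; rewrite inE unfold_in /G /= xS.
  rewrite [X in _ * X](eq_bigr (fun=> #|T|)); last first.
    move=> x xS; apply: eq_card => y.
    by rewrite unfold_in /G /= (negPf xS).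
  over.
have cardNS : #|(fun i : D => i \notin S)| = #|D| - #|S|.
  by rewrite -(cardC (mem S)) addKn; apply: eq_card.
by rewrite !prod_nat_const cardNS -[in RHS](card_ord d).
Qed.

(** The left-hand side bounds the number of pairs of sets times the number of
    tuples of maps that miss a given pair of sets of size [h], and the right-hand
    side counts all tuples.  Missing a pair costs a factor [1 + 1 / a] for each of
    the [h] points and each of the maps, and [(1 + 1 / a) ^ a] is at least [2]:
    with [a * (2 * a.+1 + 1)] maps this beats the [2 ^ (2 * a.+1 * h)] pairs. *)
Lemma union_bound_beats a h : 0 < a -> 0 < h ->
  2 ^ (a.+1 * h) * 2 ^ (a.+1 * h) *
    ((a * h) ^ h * (a.+1 * h) ^ (a * h)) ^ (a * a.+1.*2.+1)
  < (a.+1 * h) ^ (a * a.+1.*2.+1 * (a.+1 * h)).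
Proof.
move=> a_gt0 h_gt0; set e := a.+1.*2.+1; set N := a.+1 * h.
have N_gt0 : 0 < N by rewrite muln_gt0.
have core : 2 ^ N * 2 ^ N * a ^ (h * (a * e)) < a.+1 ^ (h * (a * e)).
  rewrite (mulnCA h) !(expnM _ a).
  apply: (@leq_trans (2 ^ (h * e) * (a ^ a) ^ (h * e))).
    rewrite ltn_pmul2r ?expn_gt0 ?a_gt0 // -expnD ltn_exp2l // /N /e; nia.
  by rewrite -expnMn leq_exp2r ?muln_gt0 ?h_gt0 // bernoulli_succ.
have -> : a * e * N = h * (a * e) + a * h * (a * e).
  by rewrite -mulnDl -mulSn mulnC.
have -> : ((a * h) ^ h * N ^ (a * h)) ^ (a * e)
    = a ^ (h * (a * e)) * (h ^ (h * (a * e)) * N ^ (a * h * (a * e))).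
  rewrite (expnMn (_ ^ h)) -[X in X * _]expnM -[X in _ * X]expnM expnMn.
  exact: esym (mulnA _ _ _).
have -> : N ^ (h * (a * e) + a * h * (a * e))
    = a.+1 ^ (h * (a * e)) * (h ^ (h * (a * e)) * N ^ (a * h * (a * e))).
  by rewrite expnD {1}/N expnMn; exact: esym (mulnA _ _ _).
rewrite [X in X < _](mulnA _ (a ^ _)) ltn_pmul2r //.
by rewrite muln_gt0 !expn_gt0 h_gt0 N_gt0.
Qed.

Lemma expanding_functions a h : 0 < a -> 0 < h ->
  exists F : {ffun 'I_(a * a.+1.*2.+1) * 'I_(a.+1 * h) -> 'I_(a.+1 * h)},
  forall S Y : {set 'I_(a.+1 * h)}, #|S| = h -> #|Y| = h ->
  exists j x, x \in S /\ F (j, x) \in Y.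
Proof.
move=> a_gt0 h_gt0; have := union_bound_beats a_gt0 h_gt0.
set d := a * a.+1.*2.+1; set N := a.+1 * h => beats.
pose miss (p : {set 'I_N} * {set 'I_N}) :=
  [set F : {ffun 'I_d * 'I_N -> 'I_N}
    | [forall j, forall x in p.1, F (j, x) \notin p.2]].
pose P := [set p : {set 'I_N} * {set 'I_N} | (#|p.1| == h) && (#|p.2| == h)].
(* Otherwise every tuple of maps misses some pair, and the union bound fails. *)
have [F FN] : exists F, F \notin \bigcup_(p in P) miss p.
  apply/existsP; rewrite -negb_forall; apply/negP=> /forallP all_miss.
  move: beats; apply/negP; rewrite -leqNgt.
  have <- : #|\bigcup_(p in P) miss p| = N ^ (d * N).
    have -> : \bigcup_(p in P) miss p = setT by apply/setP=> F; rewrite inE all_miss.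
    by rewrite cardsT card_ffun card_prod !card_ord.
  apply: leq_trans (card_bigcup_leq _) _.
    move=> p; rewrite inE => /andP[/eqP p1 /eqP p2].
    rewrite card_avoiding p1 p2 card_ord /N mulSn addKn.
    exact: leqnn.
  rewrite leq_mul2r; apply/orP; right; apply: leq_trans (max_card _) _.
  by rewrite card_prod -cardsT -powersetT card_powerset cardsT card_ord.
exists F => S Y Sh Yh.
have : F \notin miss (S, Y).
  apply: contra FN => FSY; apply/bigcupP; exists (S, Y) => //.
  by rewrite inE /= Sh Yh !eqxx.
rewrite inE negb_forall => /existsP[j /forall_inPn[x xS]]; rewrite negbK => FY.
by exists j, x.
Qed.

(** Remove a set [X] that is largest among those of size at most [2 * h] whose outer
    neighbourhood is no larger than [X].  It has fewer than [h] elements, or else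
    at least [h] points would be neither in [X] nor adjacent to it.  A small set
    [S] that fails to expand in the rest could be added to [X], against
    maximality. *)
Lemma prune_nonexpanding (T : finType) (e : rel T) (Y0 : {set T}) h :
  5 * h <= #|Y0| ->
  (forall S Y : {set T}, S \subset Y0 -> Y \subset Y0 -> #|S| = h -> #|Y| = h ->
     exists x y, [/\ x \in S, y \in Y & e x y]) ->
  exists Y : {set T}, [/\ Y \subset Y0, #|Y0| <= #|Y| + h &
    forall S : {set T}, S \subset Y -> #|S| <= h ->
      2 * #|S| <= #|[set y in Y | (y \in S) || [exists x in S, e x y]]|].
Proof.
move=> big joined.
pose out (X : {set T}) := [set y in Y0 :\: X | [exists x in X, e x y]].
pose P (X : {set T}) := [&& X \subset Y0, #|X| <= 2 * h & #|out X| <= #|X|].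
have P0 : P set0.
  rewrite /P sub0set cards0 /= leqn0 cards_eq0; apply/eqP/setP=> y.
  by rewrite !inE; apply/andP=> -[_ /exists_inP[x]]; rewrite inE.
case: (arg_maxnP (fun X : {set T} => #|X|) P0) => X /and3P[XY X2h outX] Xmax.
have X_small : #|X| < h.
  rewrite ltnNge; apply/negP=> /subset_of_card[S SX Sh].
  have [|Y Yrest Yh] := @subset_of_card _ (Y0 :\: X :\: out X) h.
    have := cardsID X Y0; have := cardsID (out X) (Y0 :\: X).
    have := subset_leq_card (subsetIr Y0 X).
    have := subset_leq_card (subsetIr (Y0 :\: X) (out X)); lia.
  have YP y : y \in Y -> y \in Y0 :\: X /\ y \notin out X.
    by move=> /(subsetP Yrest); rewrite [y \in _ :\: out X]inE => /andP[].
  have [||x [y [xS yY xy]]] := joined S Y _ _ Sh Yh.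
  - exact: subset_trans SX XY.
  - by apply/subsetP=> y /YP[/setDP[]].
  have [yX] := YP y yY; rewrite inE yX => /exists_inP[]; exists x => //.
  exact: (subsetP SX).
exists (Y0 :\: X); split; first exact: subsetDl.
  by have := cardsID X Y0; have := subset_leq_card (subsetIr Y0 X); lia.
move=> S SY Sh; rewrite leqNgt; apply/negP; set N := [set y in _ | _] => Nsmall.
have SN : S \subset N.
  by apply/subsetP=> y yS; rewrite inE yS (subsetP SY).
have dXS : #|X :|: S| = #|X| + #|S|.
  apply/eqP; rewrite (leq_card_setU X S); apply/pred0P=> y /=.
  apply/negP=> /andP[yX yS].
  by have := subsetP SY y yS; rewrite inE yX.
have outXS : out (X :|: S) \subset out X :|: (N :\: S).
  apply/subsetP=> y; rewrite inE => /andP[/setDP[yY0 yXS] /exists_inP[x xXS xy]].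
  have /norP[yX yS] : ~~ ((y \in X) || (y \in S)) by rewrite -in_setU.
  rewrite !inE (negPf yX) (negPf yS) yY0 /=; case/setUP: xXS => xin.
    by apply/orP; left; apply/exists_inP; exists x.
  by apply/orP; right; apply/exists_inP; exists x.
have cardNS : #|N :\: S| = #|N| - #|S|.
  by rewrite cardsD (setIidPr SN).
have : P (X :|: S).
  apply/and3P; split.
  - by rewrite subUset XY (subset_trans SY (subsetDl _ _)).
  - by rewrite dXS; lia.
  - apply: leq_trans (subset_leq_card outXS) _.
    apply: leq_trans (leq_card_setU _ _) _; rewrite dXS cardNS; lia.
by move/Xmax; rewrite dXS; lia.
Qed.

(** Sets at least double at each step until they have [h] elements, and any two
    sets of [h] elements are adjacent: this gives [spreading] with a distance
    bound that depends on the initial density only. *)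
Section Spread.
Variables (T : finType) (e : rel T) (Y : {set T}) (h : nat).
Hypotheses (e_sym : symmetric e) (e_refl : reflexive e).
Hypothesis expand : forall S : {set T}, S \subset Y -> #|S| <= h ->
  2 * #|S| <= #|[set y in Y | (y \in S) || [exists x in S, e x y]]|.
Hypothesis joined : forall S Z : {set T}, S \subset Y -> Z \subset Y ->
  #|S| = h -> #|Z| = h -> exists x y, [/\ x \in S, y \in Z & e x y].

Let V : finType := {y : T | y \in Y}.
Let eV : rel V := relpre val e.

Let ball i (Z : {set V}) := [set v | [exists z in Z, near eV i z v]].

Lemma card_ball i (Z : {set V}) : minn h (2 ^ i * #|Z|) <= #|ball i Z|.
Proof.
have eV_refl : reflexive eV by move=> v; apply: e_refl.
elim: i => [|i IH].
  rewrite mul1n; apply: leq_trans (geq_minr _ _) _.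
  apply/subset_leq_card/subsetP=> z zZ; rewrite inE; apply/exists_inP.
  by exists z => /=.
have sub : ball i Z \subset ball i.+1 Z.
  apply/subsetP=> v; rewrite !inE => /exists_inP[z zZ zv]; apply/exists_inP.
  by exists z => //; apply: near_le zv.
have [big|small] := leqP h #|ball i Z|.
  by apply: leq_trans (geq_minl _ _) _; apply: leq_trans big (subset_leq_card sub).
have imY : val @: ball i Z \subset Y.
  by apply/subsetP=> _ /imsetP[v _ ->]; apply: valP.
have card_im : #|val @: ball i Z| = #|ball i Z| by apply: card_imset val_inj.
have := expand imY; rewrite card_im => /(_ (ltnW small)) dbl.
have : #|ball i.+1 Z| >= 2 * #|ball i Z|.
  apply: leq_trans dbl _; rewrite -(card_imset (ball i.+1 Z) val_inj).
  apply/subset_leq_card/subsetP=> y; rewrite inE => /andP[yY].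
  case/orP=> [/imsetP[v vB ->]|/exists_inP[_ /imsetP[v vB ->] vy]].
    by apply: imset_f; apply: (subsetP sub).
  apply/imsetP; exists (exist _ y yY : V) => //; rewrite inE.
  move: vB; rewrite inE => /exists_inP[z zZ zv]; apply/exists_inP; exists z => //=.
  by apply/existsP; exists v; rewrite zv.
by move: IH; rewrite expnS /minn; do 2!case: ltnP; lia.
Qed.

Lemma spreading_expanding : h <= #|Y| -> spreading eV.
Proof.
move=> hY mu Z W _ Zbig Wbig.
have eV_refl : reflexive eV by move=> v; apply: e_refl.
have eV_sym : symmetric eV by move=> u v; apply: e_sym.
have big (A : {set V}) : #|V| <= mu * #|A| -> h <= #|ball mu A|.
  move=> Abig; apply: leq_trans (card_ball mu A); rewrite leq_min leqnn /=.
  apply: leq_trans hY _; rewrite -(card_sig (mem Y)); apply: leq_trans Abig _.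
  by apply: leq_mul => //; apply: ltnW; apply: ltn_expl.
have [Z' Z'Z Z'h] := subset_of_card (big Z Zbig).
have [W' W'W W'h] := subset_of_card (big W Wbig).
have [||||x [y [/imsetP[u uZ' ->] /imsetP[v vW' ->] uv]]] :=
  @joined (val @: Z') (val @: W').
- by apply/subsetP=> _ /imsetP[v _ ->]; apply: valP.
- by apply/subsetP=> _ /imsetP[v _ ->]; apply: valP.
- by rewrite card_imset //; apply: val_inj.
- by rewrite card_imset //; apply: val_inj.
have := subsetP Z'Z u uZ'; rewrite inE => /exists_inP[z zZ zu].
have := subsetP W'W v vW'; rewrite inE => /exists_inP[w wW wv].
exists z, w; split=> //.
(* Grow both sets by [mu] steps and join the results by one edge; [2 ^ mu >= mu]
   makes both large enough. *)
have -> : (2 * mu).+1 = mu + 1 + mu by lia.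
apply: near_add (near_add zu _) _; last by rewrite near_sym //; apply: wv.
by apply/existsP; exists u => /=; rewrite eqxx.
Qed.
End Spread.

(** Start from [6 * h] points.  At most [h] of them have more than six times the
    average in-degree, and pruning what remains costs at most [h] more. *)
Lemma expander_exists : exists b, forall h, 0 < h ->
  exists (V : finType) (e : rel V),
    [/\ expander b e, 4 * h <= #|V| & #|V| <= 6 * h].
Proof.
have [a a5] : exists a, a = 5 by exists 5.
have a_gt0 : 0 < a by rewrite a5.
pose d := a * a.+1.*2.+1.
exists (1 + (d + a.+1 * d)) => h h_gt0.
have [F Fexp] := expanding_functions a_gt0 h_gt0.
set N := a.+1 * h in F Fexp; rewrite -/d in F Fexp.
pose e (x y : 'I_N) := (x == y) || [exists j, (F (j, x) == y) || (F (j, y) == x)].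
have e_sym : symmetric e.
  move=> x y; rewrite /e eq_sym; congr (_ || _).
  by apply: eq_existsb => j; rewrite orbC.
have e_refl : reflexive e by move=> x; rewrite /e eqxx.
pose into x := [set p | F p == x].
pose Y0 := [set x | #|into x| <= a.+1 * d].
have d_gt0 : 0 < d by rewrite muln_gt0 a_gt0.
have Y0big : 5 * h <= #|Y0|.
  have : #|~: Y0| * (a.+1 * d) <= d * N.
    have <- : #|{: 'I_d * 'I_N}| = d * N by rewrite card_prod !card_ord.
    rewrite -sum_nat_const -sum1_card (partition_big F xpredT) //=.
    rewrite [X in _ <= X](bigID (mem (~: Y0))) /=; apply: leq_trans (leq_addr _ _).
    apply: leq_sum => x; rewrite !inE -ltnNge sum1dep_card => /ltnW xbig.
    exact: xbig.
  have rot x y z : x * (y * z) = z * (y * x) by nia.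
  rewrite (rot d).
  rewrite leq_pmul2r; last by rewrite muln_gt0 d_gt0.
  have N6 : N = 6 * h by rewrite /N a5.
  by have := cardsC Y0; rewrite card_ord; move: #|Y0| #|~: Y0| => y z; lia.
have [S Y SY0 YY0 Sh Yh|Y [YY0 Ybig Yexp]] := prune_nonexpanding (e := e) Y0big.
  have [j [x [xS xY]]] := Fexp S Y Sh Yh; exists x, (F (j, x)); split=> //.
  by rewrite /e; apply/orP; right; apply/existsP; exists j; rewrite eqxx.
exists ({y | y \in Y} : finType), (relpre val e); split; last 1 first.
- by rewrite card_sig; apply: leq_trans (max_card _) _; rewrite card_ord /N a5.
- split.
  + by move=> u v; apply: e_sym.
  + by move=> u; apply: e_refl.
  + move=> v; rewrite -(card_imset _ val_inj).
    set x := val v; apply: (@leq_trans #|[set x] :|: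
      ([set F (j, x) | j : 'I_d] :|: [set p.2 | p in into x])|).
      apply/subset_leq_card/subsetP=> y /imsetP[w]; rewrite inE => vw -> {y}.
      case/orP: vw => [/eqP <-|/existsP[j]]; first by rewrite !inE eqxx.
      case/orP=> /eqP Fj; apply/setUP; right; apply/setUP; [left|right].
        by apply/imsetP; exists j.
      by apply/imsetP; exists (j, val w); rewrite ?inE //= Fj.
    apply: leq_trans (leq_card_setU _ _) (leq_add _ _); first by rewrite cards1.
    apply: leq_trans (leq_card_setU _ _) (leq_add _ _).
      by apply: leq_trans (leq_imset_card _ _) _; rewrite card_ord.
    apply: leq_trans (leq_imset_card _ _) _.
    by have := subsetP YY0 x (valP v); rewrite inE.
  + apply: (spreading_expanding (h := h)) => //; last by lia.
    move=> S Z SY ZY Sh Zh; have [j [x [xS xZ]]] := Fexp S Z Sh Zh.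
    exists x, (F (j, x)); split=> //.
    by rewrite /e; apply/orP; right; apply/existsP; exists j; rewrite eqxx.
- rewrite card_sig (eq_card (B := Y)) //; move: Y0big Ybig; clear; lia.
Qed.

(** * The size-Ramsey number of a power of a path *)

Lemma blowup_ramsey_all k s b j : 0 < k ->
  exists r t L N, 0 < t /\ blowup_ramsey k s b j r t L N.
Proof.
move=> k_gt0; elim: j => [|j [r [t [L [N [t_gt0 IH]]]]]].
  by exists 0, 2, 0, 1; split=> //; apply: blowup_ramsey0.
exact: blowup_ramseyS IH.
Qed.

Section Blowup.
Variables (V : finType) (e : rel V) (r t : nat).
Hypothesis e_sym : symmetric e.

Definition blowup_adj : rel (V * 'I_t) := fun x y => (x != y) && near e r x.1 y.1.

Lemma blowup_adj_sym : symmetric blowup_adj.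
Proof. by move=> x y; rewrite /blowup_adj eq_sym near_sym. Qed.

Lemma blowup_adj_irrefl : irreflexive blowup_adj.
Proof. by move=> x; rewrite /blowup_adj eqxx. Qed.

Definition blowup : sgraph := SGraph blowup_adj_sym blowup_adj_irrefl.

Lemma card_edges_blowup b : (forall v, #|[set w | e v w]| <= b) ->
  #|edges blowup| <= #|V| * t * (b ^ r * t).
Proof.
move=> deg; apply: leq_trans (leq_imset_card _ _) _.
apply: (@leq_trans #|\bigcup_(x in [set: V * 'I_t])
    [set (x, y) | y in setX [set v | near e r x.1 v] [set: 'I_t]]|).
  apply/subset_leq_card/subsetP=> -[x y]; rewrite inE /= => /andP[_ xy].
  by apply/bigcupP; exists x; rewrite ?inE //; apply: imset_f; rewrite !inE xy.
apply: leq_trans (card_bigcup_leq (m := b ^ r * t) _) _.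
  move=> x _; apply: leq_trans (leq_imset_card _ _) _.
  by rewrite cardsX cardsT card_ord leq_mul2r card_near ?orbT.
by rewrite cardsT card_prod card_ord.
Qed.
End Blowup.

(** A step in the path graph changes the index by one, so vertices adjacent in the
    [k]th power have indices that differ by at most [k]. *)
Lemma walk_path_graph n d (x y : path_graph n) : walk d x y -> x <= y + d /\ y <= x + d.
Proof.
case/walkP=> p [<- xp <-] {d y}.
elim: p x xp => [|z p IH] x /=; first by rewrite addn0.
by case/andP=> /orP[]/eqP xz /IH [] /= le1 le2; split; lia.
Qed.

Lemma power_path_copy n k (G : sgraph) (Q : rel G) (p : seq G) :
  symmetric Q -> uniq p -> n < size p -> power_path k Q p ->
  exists f : power (path_graph n) k -> G, injective f /\
    forall x y : power (path_graph n) k, adj x y -> Q (f x) (f y).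
Proof.
case: p => // x0 p Qsym pU np pQ.
exists (fun i : 'I_n => nth x0 (x0 :: p) i); split=> [i j /eqP|].
  by rewrite nth_uniq ?(ltn_trans (ltn_ord _)) // => /eqP/val_inj.
suff Q_lt (i j : 'I_n) : i < j -> j <= i + k ->
    Q (nth x0 (x0 :: p) i) (nth x0 (x0 :: p) j).
  move=> i j /andP[ij]; case E : dist => [d|//] dk.
  have [/walk_path_graph [ijd jid] _] := (@distP (path_graph n) i j d).1 E.
  case: (ltngtP (i : 'I_n) (j : 'I_n)) => [lt|gt|/val_inj eq_ij].
  - by apply: Q_lt => //; apply: leq_trans jid _; rewrite leq_add2l.
  - by rewrite Qsym; apply: Q_lt => //; apply: leq_trans ijd _; rewrite leq_add2l.
  - by rewrite eq_ij eqxx in ij.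
by move=> ij jk; apply: power_path_nth pQ ij jk _; apply: ltn_trans (ltn_ord j) np.
Qed.

Lemma ex_least (P : nat -> Prop) n : P n ->
  exists2 m, P m /\ (forall i, P i -> m <= i) & m <= n.
Proof.
elim/ltn_ind: n => n IH Pn.
have [[i [i_n Pi]]|none] := classic (exists i, i < n /\ P i).
  by have [m Pm mi] := IH i i_n Pi; exists m => //; apply: leq_trans mi (ltnW i_n).
exists n => //; split=> // i Pi; rewrite leqNgt; apply/negP=> i_n.
by apply: none; exists i.
Qed.

Theorem theorem1p2 (s k : nat) (hs : 1 <= s) (hk : 1 <= k) :
  exists K N : nat, forall n : nat, N <= n ->
    exists2 r : nat, is_size_ramsey s (power (path_graph n) k) r & r <= K * n.
Proof.
have [b expanders] := expander_exists.
have [r [t [L [N [t_gt0 claim]]]]] := blowup_ramsey_all s b s hk.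
exists (6 * (L + N.+1) * (t * (b ^ r * t))), 1 => n n_gt0.
have [|V [e [ex Vge Vle]]] := expanders (L * n + N.+1); first by lia.
have [e_sym e_refl deg spr] := ex.
pose G := blowup r t e_sym.
suff arr : arrows s G (power (path_graph n) k).
  have [m [[G' G'arr G'm] least] mG] := @ex_least
    (fun m => exists2 G : sgraph, arrows s G (power (path_graph n) k) & #|edges G| = m)
    _ (ex_intro2 _ _ G arr erefl).
  exists m; first by split; [exists G'|move=> G0 G0arr; apply: least; exists G0].
  apply: leq_trans mG (leq_trans (card_edges_blowup _ _ _ deg) _).
  rewrite -[_ * t * _]mulnA [X in _ <= X]mulnAC leq_mul2r; apply/orP; right.
  apply: leq_trans Vle _; rewrite -mulnA leq_mul2l /= mulnDl leq_add2l.
  by rewrite leq_pmulr.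
move=> c.
pose R a (x y : G) := [exists ed : edge G, (val ed == [set x; y]) && (c ed == a)].
have Rsym a : symmetric (R a).
  by move=> x y; apply: eq_existsb => ed; rewrite setUC.
have [|||u v i i' _ _ []|u v i i' _ _ uv ne|a [p [pU pQ pV]]] :=
  claim V (V * 'I_t)%type e R setT setT pair ex _ _ Rsym.
- by lia.
- by rewrite cardsT; lia.
- by rewrite cardsT card_ord.
- by move=> -> ->.
- have ed_in : [set (u, i); (v, i')] \in edges G.
    by rewrite (@mem_edges G); apply/andP.
  pose ed : edge G := Sub [set (u, i); (v, i')] ed_in.
  by exists (c ed); rewrite ?inE //; apply/existsP; exists ed; rewrite !eqxx.
have np : n < size p.
  have : L * n < L * size p by lia.
  by rewrite ltn_mul2l => /andP[].
have [f [f_inj fQ]] := power_path_copy (Rsym a) pU np pQ.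
exists a, f; split=> // x y /fQ /existsP[ed /andP[/eqP edE /eqP edc]].
by exists ed.
Qed.
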